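(* Let $T:V\to L$ be an $\mathcal{O}$-operator on a L.t.sRep pair $(L,[\cdot,\cdot,\cdot];\theta)$, with $\theta$ a representation on $V$. Let $T_t=T+tT_1$ and $T'_t=T+tT'_1$ be two equivalent infinitesimal deformations of $T$. Then $T_1$ and $T'_1$ define the same cohomology class in $H_T^1(V;L)$.
   Context: All vector spaces are over a field of characteristic $0$. A Lie triple system (L.t.s) is a vector space $L$ with a trilinear bracket $[\cdot,\cdot,\cdot]:\wedge^2L\otimes L\to L$ (skew-symmetric in the first two arguments) such that for all $x,y,z,t,e\in L$: $[x,y,z]+[y,z,x]+[z,x,y]=0$ and $[x,y,[z,t,e]]=[[x,y,z],t,e]+[z,[x,y,t],e]+[z,t,[x,y,e]]$. A morphism of L.t.s is a linear map preserving the ternary brackets. A representation of $L$ on a vector space $V$ is a bilinear map $\theta:\otimes^2L\to End(V)$ such that, with $D(x,y)=\theta(y,x)-\theta(x,y)$, for all $x,y,z,t\in L$: $\theta(z,t)\theta(x,y)-\theta(y,t)\theta(x,z)-\theta(x,[y,z,t])+D(y,z)\theta(x,t)=0$ and $\theta(z,t)D(x,y)-D(x,y)\theta(z,t)+\theta([x,y,z],t)+\theta(z,[x,y,t])=0$. A L.t.s together with a representation is called a L.t.sRep pair $(L,[\cdot,\cdot,\cdot];\theta)$. For $\mathfrak{X}=x\wedge y\in L\wedge L$ write $D(\mathfrak{X})=D(x,y)$, $[\mathfrak{X},z]=[x,y,z]$, extended linearly. A linear map $T:V\to L$ is an $\mathcal{O}$-operator on the pair if $[Tu,Tv,Tw]=T\big(D(Tu,Tv)w+\theta(Tv,Tw)u-\theta(Tu,Tw)v\big)$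 for all $u,v,w\in V$. Then $V$ is a L.t.s under $[u,v,w]_T=D(Tu,Tv)w+\theta(Tv,Tw)u-\theta(Tu,Tw)v$, and $\theta_T(u,v)x=[x,Tu,Tv]+T\big(\theta(x,Tv)u-D(x,Tu)v\big)$ is a representation of it on $L$; put $D_T(u,v)=\theta_T(v,u)-\theta_T(u,v)$. A morphism from an $\mathcal{O}$-operator $T$ to an $\mathcal{O}$-operator $T'$ on the same pair is a pair $(\phi,\psi)$ of a L.t.s morphism $\phi:L\to L$ and a linear map $\psi:V\to V$ with $\phi\circ T=T'\circ\psi$ and $\psi\,\theta(x,y)=\theta(\phi(x),\phi(y))\,\psi$ for all $x,y\in L$. Degree-one cohomology of $T$: $Z_T^1(V,L)$ is the space of linear maps $f:V\to L$ with $D_T(v_1,v_2)f(v_3)-\theta_T(v_1,v_3)f(v_2)+\theta_T(v_2,v_3)f(v_1)-f([v_1,v_2,v_3]_T)=0$ for all $v_i\in V$; $B_T^1(V,L)=\{d_T\mathfrak{X}\mid\mathfrak{X}\in L\wedge L\}$ where $(d_T\mathfrak{X})(v)=TD(\mathfrak{X})v-[\mathfrak{X},Tv]$; and $H_T^1(V;L)=Z_T^1(V,L)/B_T^1(V,L)$. $T_t=T+tT_1$ with $T_1\in Hom(V,L)$ is an infinitesimal deformation of $T$ if $T_t$ is an $\mathcal{O}$-operator for all values of $t$. Two infinitesimal deformations $T_t$ and $T'_t$ are equivalent if there is $\mathfrak{X}\in L\wedge L$ such that the pair $(\phi_t=Id_L+t[\mathfrak{X},-],\ \psi_t=Id_V+tD(\mathfrak{X})(-))$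 is a morphism of $\mathcal{O}$-operators from $T_t$ to $T'_t$ (for all values of $t$). *)

(* Defs.v *)
From HB Require Import structures.
From mathcomp Require Import all_boot all_algebra.
From mathcomp Require Import boolp functions.
From mathcomp Require Import freeg.

Set Implicit Arguments.
Unset Strict Implicit.
Unset Printing Implicit Defensive.

Import GRing.Theory.

Local Open Scope ring_scope.
Local Open Scope quotient_scope.

(* The quotient of a module by a submodule: [Quotient.quot] gives the group, to
   which the scaling is added.  [zmod_part] recalls that a submodule is closed
   under opposites, which [submodClosed] does not record. *)
Section QuotientModule.
Variables (K : pzRingType) (W : lmodType K) (S : submodClosed W).

Definition zmod_part : {pred W} := S.

Fact zmod_part_closed : zmod_closed zmod_part.
Proof. exact: GRing.submod_closedB (GRing.submodClosedP S). Qed.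

HB.instance Definition _ :=
  GRing.isZmodClosed.Build W zmod_part zmod_part_closed.

Definition quotmod := Quotient.quot zmod_part.

HB.instance Definition _ := GRing.Zmodule.on quotmod.

Definition quotmod_class (w : W) : quotmod := \pi_(Quotient.quot zmod_part) w.

Definition quotmod_scale (a : K) (x : quotmod) : quotmod :=
  quotmod_class (a *: (repr x : W)).

Lemma quotmod_classP (u v : W) :
  quotmod_class u = quotmod_class v <-> u - v \in S.
Proof.
rewrite -[u - v \in S]/(u - v \in zmod_part) Quotient.idealrBE.
by split=> /eqP.
Qed.

Lemma quotmod_classK (x : quotmod) : quotmod_class (repr x) = x.
Proof. exact: reprK. Qed.

Lemma quotmod_classD : {morph quotmod_class : u v / u + v}.
Proof. by move=> u v; rewrite /quotmod_class raddfD. Qed.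

Lemma quotmod_classZ a u : quotmod_scale a (quotmod_class u) = quotmod_class (a *: u).
Proof.
apply/quotmod_classP; rewrite -scalerBr rpredZ //.
by apply/quotmod_classP; rewrite quotmod_classK.
Qed.

Fact quotmod_scalerA a b (x : quotmod) :
  quotmod_scale a (quotmod_scale b x) = quotmod_scale (a * b) x.
Proof. by rewrite -[x]quotmod_classK !quotmod_classZ scalerA. Qed.

Fact quotmod_scale1r : left_id 1 quotmod_scale.
Proof. by move=> x; rewrite -[x]quotmod_classK quotmod_classZ scale1r. Qed.

Fact quotmod_scalerDr : right_distributive quotmod_scale +%R.
Proof.
move=> a x y; rewrite -[x]quotmod_classK -[y]quotmod_classK.
by rewrite -quotmod_classD !quotmod_classZ -quotmod_classD scalerDr.
Qed.

Fact quotmod_scalerDl (x : quotmod) : {morph quotmod_scale^~ x : a b / a + b}.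
Proof.
move=> a b; rewrite -[x]quotmod_classK.
by rewrite !quotmod_classZ scalerDl quotmod_classD.
Qed.

HB.instance Definition _ := GRing.Zmodule_isLmodule.Build K quotmod
  quotmod_scalerA quotmod_scale1r quotmod_scalerDr quotmod_scalerDl.

Fact quotmod_class_linear : linear quotmod_class.
Proof. by move=> a u v; rewrite quotmod_classD -quotmod_classZ. Qed.

HB.instance Definition _ :=
  GRing.isLinear.Build K W quotmod _ quotmod_class quotmod_class_linear.

End QuotientModule.

(* The exterior square of [L]: the free module on [L * L] modulo bilinearity and
   alternation. *)
Section ExteriorSquare.
Variables (K : fieldType) (L : lmodType K).

Inductive wedge_relation : {freeg (L * L) / K} -> Prop :=
| WedgeRel0 : wedge_relation 0
| WedgeRelLin a u v :
    wedge_relation u -> wedge_relation v -> wedge_relation (a *: u + v)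
| WedgeRelBilinl a x x' y :
    wedge_relation (<< (a *: x + x', y) >> - (a *: << (x, y) >> + << (x', y) >>))
| WedgeRelBilinr a x y y' :
    wedge_relation (<< (x, a *: y + y') >> - (a *: << (x, y) >> + << (x, y') >>))
| WedgeRelAlt x : wedge_relation << (x, x) >>.

Definition wedge_relations : {pred {freeg (L * L) / K}} :=
  fun w => `[< wedge_relation w >].

Fact wedge_relations_closed : submod_closed wedge_relations.
Proof.
split=> [|a u v /asboolP ru /asboolP rv]; apply/asboolP; first exact: WedgeRel0.
exact: WedgeRelLin.
Qed.

HB.instance Definition _ := GRing.isSubmodClosed.Build K {freeg (L * L) / K}
  wedge_relations wedge_relations_closed.

Definition extsq := quotmod wedge_relations.

HB.instance Definition _ := GRing.Lmodule.on extsq.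

Definition wedge (x y : L) : extsq := quotmod_class wedge_relations << (x, y) >>.

Variable U : lmodType K.

(* The linear extension of [x ∧ y |-> f x y]; only meaningful when [f] is
   bilinear and alternating, see [wedge_liftE] and [wedge_lift_linear]. *)
Definition wedge_lift (f : L -> L -> U) (X : extsq) : U :=
  fglift (fun p => f p.1 p.2) (repr X).

Section WedgeLift.
Variable f : L -> L -> U.
Hypothesis f_linl : forall y, linear (f^~ y).
Hypothesis f_linr : forall x, linear (f x).
Hypothesis f_alt : forall x, f x x = 0.

Let flift (w : {freeg (L * L) / K}) : U := fglift (fun p => f p.1 p.2) w.

Let fliftB : {morph flift : u v / u - v}.
Proof. exact: lift_is_additive. Qed.

Let flift0 : flift 0 = 0.
Proof. by rewrite -(subrr 0) fliftB subrr. Qed.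

Let fliftD : {morph flift : u v / u + v}.
Proof.
by move=> u v; rewrite -[v in LHS]opprK -[- v]sub0r !fliftB flift0 sub0r opprK.
Qed.

Let flift_linear : linear flift.
Proof.
move=> a u v; rewrite fliftD; congr (_ + _).
have -> : a *: u = \sum_(z <- dom u) << (a * coeff z u) *g z >> by [].
rewrite -[u in RHS]freeg_sumE !(big_morph flift fliftD flift0) scaler_sumr.
by apply: eq_bigr => z _; rewrite /flift !liftU scalerA.
Qed.

Let flift_eq0 w : wedge_relation w -> flift w = 0.
Proof.
elim=> [|a u v _ u0 _ v0|a x x' y|a x y y'|x].
- exact: flift0.
- by rewrite flift_linear u0 v0 scaler0 addr0.
- by rewrite fliftB flift_linear /flift !liftU !scale1r /= f_linl subrr.
- by rewrite fliftB flift_linear /flift !liftU !scale1r /= f_linr subrr.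
- by rewrite /flift liftU /= f_alt scaler0.
Qed.

Let wedge_lift_class w :
  wedge_lift f (quotmod_class wedge_relations w) = flift w.
Proof.
apply/eqP; rewrite -subr_eq0 -[wedge_lift f _]/(flift _) -fliftB.
apply/eqP/flift_eq0/asboolP.
by apply/(quotmod_classP wedge_relations); rewrite quotmod_classK.
Qed.

Lemma wedge_liftE x y : wedge_lift f (wedge x y) = f x y.
Proof. by rewrite wedge_lift_class /flift liftU scale1r. Qed.

Lemma wedge_lift_linear : linear (wedge_lift f).
Proof.
move=> a X Y; rewrite -[X]quotmod_classK -[Y]quotmod_classK -linearP.
by rewrite !wedge_lift_class flift_linear.
Qed.

End WedgeLift.

End ExteriorSquare.

(* A bilinear map factors through the exterior square iff it is alternating; in
   characteristic 0 this is the same as being skew-symmetric. *)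
Lemma alternating_skew (K : fieldType) (L U : lmodType K) (b : L -> L -> U)
    (b_linl : forall y, linear (b^~ y)) (b_linr : forall x, linear (b x)) :
  [pchar K] =i pred0 ->
  (forall x, b x x = 0) <-> (forall x y, b x y = - b y x).
Proof.
move=> charK; split=> [b_alt x y|b_skew x].
  have bDl u v w : b (u + v) w = b u w + b v w.
    by have := b_linl w 1 u v; rewrite !scale1r.
  have bDr u v w : b w (u + v) = b w u + b w v.
    by have := b_linr w 1 u v; rewrite !scale1r.
  have := b_alt (x + y); rewrite bDl !bDr !b_alt add0r addr0 => /eqP.
  by rewrite addr_eq0 => /eqP.
apply/eqP; have : 2%:R *: b x x = 0.
  by rewrite scaler_nat mulr2n [X in X + _]b_skew addNr.
by move/eqP; rewrite scaler_eq0 ((pcharf0P _).1 charK).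
Qed.

HB.mixin Record isLieTripleSystem (K : fieldType) L of GRing.Lmodule K L := {
  tbr : L -> L -> L -> L;
  tbr_linear1 : forall y z, linear (fun x => tbr x y z);
  tbr_linear2 : forall x z, linear (fun y => tbr x y z);
  tbr_linear3 : forall x y, linear (tbr x y);
  tbr_alt : forall x z, tbr x x z = 0;
  tbr_cyclic : forall x y z, tbr x y z + tbr y z x + tbr z x y = 0;
  tbr_derivation : forall x y z t e,
    tbr x y (tbr z t e)
    = tbr (tbr x y z) t e + tbr z (tbr x y t) e + tbr z t (tbr x y e)
}.

#[short(type="ltsType")]
HB.structure Definition LieTripleSystem (K : fieldType) :=
  {L of isLieTripleSystem K L & GRing.Lmodule K L}.

Lemma tbr_skew (K : fieldType) (L : ltsType K) (x y z : L) :
  tbr x y z = - tbr y x z.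
Proof.
have D1 u v w t : tbr (u + v) w t = tbr u w t + tbr v w t :> L.
  by have := tbr_linear1 w t 1 u v; rewrite !scale1r.
have D2 u v w t : tbr t (u + v) w = tbr t u w + tbr t v w :> L.
  by have := tbr_linear2 t w 1 u v; rewrite !scale1r.
have := tbr_alt (x + y) z; rewrite D1 !D2 !tbr_alt add0r addr0 => /eqP.
by rewrite addr_eq0 => /eqP.
Qed.

Notation "[ 'br' x , y , z ]" := (tbr x y z) (format "[ 'br'  x ,  y ,  z ]").

Record lts_morphism (K : fieldType) (L L' : ltsType K) (phi : L -> L') : Prop := {
  lts_morphism_linear : linear phi;
  lts_morphism_br : forall x y z,
    phi [br x, y, z] = [br phi x, phi y, phi z]
}.

Definition rep_D (K : fieldType) (L V : lmodType K) (theta : L -> L -> V -> V)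
  (x y : L) : V -> V := fun v => theta y x v - theta x y v.

Record ltsRep (K : fieldType) (L : ltsType K) (V : lmodType K) := LtsRep {
  rep :> L -> L -> V -> V;
  rep_linear : forall x y, linear (rep x y);
  rep_linear1 : forall y, linear (rep^~ y);
  rep_linear2 : forall x, linear (rep x);
  rep_thetaE : forall x y z t v,
    rep z t (rep x y v) - rep y t (rep x z v) - rep x [br y, z, t] v
      + rep_D rep y z (rep x t v) = 0;
  rep_DE : forall x y z t v,
    rep z t (rep_D rep x y v) - rep_D rep x y (rep z t v)
      + rep [br x, y, z] t v + rep z [br x, y, t] v = 0
}.

Section Operators.
Variables (K : fieldType) (L : ltsType K) (V : lmodType K) (theta : ltsRep L V).

Local Notation D := (rep_D theta).

Definition wedge_D (X : extsq L) : V -> V := wedge_lift D X.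

Definition wedge_br (X : extsq L) : L -> L := wedge_lift (@tbr K L) X.

Fact rep_D_linear1 y : linear (D^~ y).
Proof.
move=> a u v; apply/funext=> w; rewrite /rep_D fctE.
rewrite (rep_linear1 theta y a u v) (rep_linear2 theta y a u v) !fctE.
by rewrite scalerBr opprD addrACA.
Qed.

Fact rep_D_linear2 x : linear (D x).
Proof.
move=> a u v; apply/funext=> w; rewrite /rep_D fctE.
rewrite (rep_linear1 theta x a u v) (rep_linear2 theta x a u v) !fctE.
by rewrite scalerBr opprD addrACA.
Qed.

Fact rep_D_alt x : D x x = 0.
Proof. by apply/funext=> w; rewrite /rep_D subrr. Qed.

Fact tbr_fct_linear1 y : linear ((@tbr K L)^~ y).
Proof. by move=> a u v; apply/funext=> w; rewrite (tbr_linear1 y w a u v). Qed.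

Fact tbr_fct_linear2 x : linear (@tbr K L x).
Proof. by move=> a u v; apply/funext=> w; rewrite (tbr_linear2 x w a u v). Qed.

Fact tbr_fct_alt x : @tbr K L x x = 0.
Proof. by apply/funext=> w; exact: tbr_alt. Qed.

Lemma wedge_D_wedge x y : wedge_D (wedge x y) = D x y.
Proof. exact: (wedge_liftE rep_D_linear1 rep_D_linear2 rep_D_alt). Qed.

Lemma wedge_D_linear : linear wedge_D.
Proof. exact: (wedge_lift_linear rep_D_linear1 rep_D_linear2 rep_D_alt). Qed.

Lemma wedge_br_wedge x y z : wedge_br (wedge x y) z = [br x, y, z].
Proof.
by rewrite /wedge_br (wedge_liftE tbr_fct_linear1 tbr_fct_linear2 tbr_fct_alt).
Qed.

Lemma wedge_br_linear : linear wedge_br.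
Proof.
exact: (wedge_lift_linear tbr_fct_linear1 tbr_fct_linear2 tbr_fct_alt).
Qed.

(* The triple bracket [u, v, w]_T of [V]. *)
Definition br_O (T : V -> L) (u v w : V) : V :=
  D (T u) (T v) w + theta (T v) (T w) u - theta (T u) (T w) v.

Definition O_operator (T : {linear V -> L}) : Prop :=
  forall u v w, [br T u, T v, T w] = T (br_O T u v w).

Record O_morphism (T T' : V -> L) (phi : L -> L) (psi : V -> V) : Prop := {
  O_morphism_lts : lts_morphism phi;
  O_morphism_linear : linear psi;
  O_morphism_comm : forall v, phi (T v) = T' (psi v);
  O_morphism_rep : forall x y v,
    psi (theta x y v) = theta (phi x) (phi y) (psi v)
}.

Definition deformation (T T1 : {linear V -> L}) (t : K) : {linear V -> L} :=
  T \+ (t \*: T1).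

Definition inf_deformation (T T1 : {linear V -> L}) : Prop :=
  forall t : K, O_operator (deformation T T1 t).

Definition equiv_deformation (T T1 T1' : {linear V -> L}) : Prop :=
  exists X : extsq L, forall t : K,
    O_morphism (deformation T T1 t) (deformation T T1' t)
      (fun x => x + t *: wedge_br X x) (fun v => v + t *: wedge_D X v).

End Operators.

Section Cohomology.
Variables (K : fieldType) (L : ltsType K) (V : lmodType K) (theta : ltsRep L V).
Variable T : {linear V -> L}.

(* The representation theta_T of [V] on [L]; its D_T is [rep_D theta_O]. *)
Definition theta_O (u v : V) (x : L) : L :=
  [br x, T u, T v] + T (theta x (T v) u - rep_D theta x (T u) v).

Definition cocycle1_pred : {pred V -> L} := fun f =>
  `[< linear f /\
      forall v1 v2 v3 : V,
        rep_D theta_O v1 v2 (f v3) - theta_O v1 v3 (f v2)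
        + theta_O v2 v3 (f v1) - f (br_O theta T v1 v2 v3) = 0 >].

Fact theta_O_linear u v : linear (theta_O u v).
Proof.
move=> a x y; rewrite /theta_O /rep_D (tbr_linear1 _ _ a x y).
have th1 z w : theta (a *: x + y) z w = a *: theta x z w + theta y z w.
  by rewrite (rep_linear1 theta z a x y).
have th2 z w : theta z (a *: x + y) w = a *: theta z x w + theta z y w.
  by rewrite (rep_linear2 theta z a x y).
have subACA (p p' q q' : V) : (p + p') - (q + q') = (p - q) + (p' - q').
  by rewrite opprD addrACA.
by rewrite !th1 th2 scalerDr addrACA -linearP (subACA (a *: theta (T u) x v)) subACA !scalerBr.
Qed.

Fact cocycle1_closed : submod_closed cocycle1_pred.
Proof.
have th0 u v : theta_O u v 0 = 0.
  have := theta_O_linear u v (-1) 0 0.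
  by rewrite scaler0 addr0 scaleN1r addNr.
have comb a (p q r s t p' q' r' s' t' : L) :
    a *: p + p' - (a *: q + q') - (a *: r + r') + (a *: s + s') - (a *: t + t')
    = a *: (p - q - r + s - t) + (p' - q' - r' + s' - t').
  have subACA (x x' y y' : L) : (x + x') - (y + y') = (x - y) + (x' - y').
    by rewrite opprD addrACA.
  rewrite (subACA _ _ (a *: q)) (subACA _ _ (a *: r)) (addrACA _ _ (a *: s)).
  by rewrite subACA -!scalerBr -scalerDr -scalerBr.
split=> [|a f g /asboolP[linf cf] /asboolP[ling cg]]; apply/asboolP; split.
- by move=> a u v; rewrite -[RHS]/(a *: 0 + 0) scaler0 addr0.
- have z v : (0 : V -> L) v = 0 by [].
  by move=> v1 v2 v3; rewrite /rep_D !z !th0 !subr0 addr0.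
- move=> b u v; rewrite !fctE linf ling !scalerDr !scalerA (mulrC b).
  by rewrite addrACA.
- have e v : (a *: f + g) v = a *: f v + g v by [].
  move=> v1 v2 v3; have := cf v1 v2 v3; have := cg v1 v2 v3.
  by rewrite /rep_D !e !theta_O_linear comb => -> ->; rewrite scaler0 addr0.
Qed.

HB.instance Definition _ :=
  GRing.isSubmodClosed.Build K (V -> L) cocycle1_pred cocycle1_closed.

Definition cocycle1 := {f : V -> L | f \in cocycle1_pred}.

HB.instance Definition _ := [isSub of cocycle1 for sval].
HB.instance Definition _ := [Choice of cocycle1 by <:].
HB.instance Definition _ := [SubChoice_isSubLmodule of cocycle1 by <:].

Lemma sval_cocycle1B (f g : cocycle1) v : sval (f - g) v = sval f v - sval g v.
Proof. by []. Qed.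

Definition d_O (X : extsq L) : V -> L :=
  fun v => T (wedge_D theta X v) - wedge_br X (T v).

(* [d_O X] is a cocycle when [T] is an O-operator, so that these are all the
   [d_O X]. *)
Definition coboundary1 : {pred cocycle1} := fun f =>
  `[< exists X : extsq L, sval f = d_O X >].

Fact d_O_linear : linear d_O.
Proof.
move=> a X Y; apply/funext=> v; rewrite /d_O wedge_D_linear wedge_br_linear.
by rewrite !fctE linearP scalerBr opprD addrACA.
Qed.

Fact coboundary1_closed : submod_closed coboundary1.
Proof.
split=> [|a f g /asboolP[X fX] /asboolP[Y gY]]; apply/asboolP.
  exists 0; have := d_O_linear (-1) 0 0.
  by rewrite scaler0 addr0 scaleN1r addNr => ->.
by exists (a *: X + Y); rewrite d_O_linear -fX -gY.
Qed.

HB.instance Definition _ :=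
  GRing.isSubmodClosed.Build K cocycle1 coboundary1 coboundary1_closed.

Definition cohomology1 := quotmod coboundary1.

HB.instance Definition _ := GRing.Lmodule.on cohomology1.

Definition cohomology1_class (f : cocycle1) : cohomology1 :=
  quotmod_class coboundary1 f.

End Cohomology.

(* Main.v *)
Require Import Defs.
From mathcomp Require Import all_boot all_algebra.
From mathcomp Require Import boolp functions ring.

Set Implicit Arguments.
Unset Strict Implicit.
Unset Printing Implicit Defensive.

Import GRing.Theory.
Local Open Scope ring_scope.

(** Everything is read off the coefficient of [t] in two identities that are
    polynomial in [t].

    The failure of [T] to be an O-operator is the diagonal value of a map
    [O_defect] of three linear maps, affine along pencils in each of them.  The
    defect of [T + t S] is therefore a cubic in [t] whose constant term is the
    defect of [T] and whose linear coefficient is the sum of the three defects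
    in which one [T] is replaced by [S] ([O_defect_first_order]).  If all
    [T + t S] are O-operators, this coefficient vanishes.  On the other hand
    the three summands are, up to terms that add up to [S] of the bracket of
    [V], the three terms [theta_T (v, w) (S u)], [- theta_T (u, w) (S v)] and
    [D_T (u, v) (S w)] of the cocycle condition, so that [S] is a cocycle
    ([inf_deformation_cocycle]).

    For an equivalence given by [X], the condition [phi_t T_t = T'_t psi_t] is
    quadratic in [t]; its linear coefficient is
    [T1 v + [X, T v] = T1' v + T (D X v)], that is, [T1 - T1'] is the
    coboundary of [X] ([equiv_deformation_d_O]).

    Characteristic 0 provides enough values of [t] to separate the coefficients
    ([cubic_vanish]). *)

(** Three values of [t] determine the linear coefficient of such a cubic as soon
    as 6 is invertible. *)
Lemma cubic_vanish (K : fieldType) (U : lmodType K) (A B C : U) :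
  [pchar K] =i pred0 ->
  (forall t : K, t *: A + t ^+ 2 *: B + t ^+ 3 *: C = 0) -> A = 0.
Proof.
move=> charK P0; apply/eqP; have : (6%:R : K) *: A == 0.
  (* 6 P(1) - 2 P(-1) - P(2) isolates the linear coefficient. *)
  have <- : (6%:R : K) *: (1 *: A + 1 ^+ 2 *: B + 1 ^+ 3 *: C)
      + (- 2%:R : K) *: (-1 *: A + (-1) ^+ 2 *: B + (-1) ^+ 3 *: C)
      + (-1 : K) *: (2%:R *: A + 2%:R ^+ 2 *: B + 2%:R ^+ 3 *: C)
      = 6%:R *: A.
    have addr3 (a b c a' b' c' : U) :
        a + b + c + (a' + b' + c') = (a + a') + (b + b') + (c + c').
      by rewrite addrACA (addrACA a).
    rewrite !scalerDr !scalerA.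
    rewrite !(addr3 (_ *: A) (_ *: B) (_ *: C) (_ *: A) (_ *: B) (_ *: C),
      =^~ scalerDl).
    (* Only the coefficient of [A] survives; those of [B] and [C] are 0. *)
    rewrite -[RHS]addr0 -[RHS]addr0.
    by congr (_ *: _ + _ + _); [ring | apply/eqP.. ];
      rewrite scaler_eq0; apply/orP; left; apply/eqP; ring.
  by rewrite !P0 !scaler0 !addr0.
by rewrite scaler_eq0 ((pcharf0P _).1 charK).
Qed.

Section FirstOrder.
Variables (K : fieldType) (L : ltsType K) (V : lmodType K) (theta : ltsRep L V).

Lemma rep_affine1 (x x' y : L) v (t : K) :
  theta (x + t *: x') y v = theta x y v + t *: theta x' y v.
Proof. by rewrite addrC (rep_linear1 theta y t x' x) !fctE addrC. Qed.

Lemma rep_affine2 (x y y' : L) v (t : K) :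
  theta x (y + t *: y') v = theta x y v + t *: theta x y' v.
Proof. by rewrite addrC (rep_linear2 theta x t y' y) !fctE addrC. Qed.

Lemma rep_D_affine1 (x x' y : L) v (t : K) :
  rep_D theta (x + t *: x') y v = rep_D theta x y v + t *: rep_D theta x' y v.
Proof. by rewrite addrC (rep_D_linear1 theta y t x' x) !fctE addrC. Qed.

Lemma rep_D_affine2 (x y y' : L) v (t : K) :
  rep_D theta x (y + t *: y') v = rep_D theta x y v + t *: rep_D theta x y' v.
Proof. by rewrite addrC (rep_D_linear2 theta x t y' y) !fctE addrC. Qed.

Lemma tbr_affine1 (x x' y z : L) (t : K) :
  [br x + t *: x', y, z] = [br x, y, z] + t *: [br x', y, z].
Proof. by rewrite addrC (tbr_linear1 y z t x' x) addrC. Qed.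

Lemma tbr_affine2 (x y y' z : L) (t : K) :
  [br x, y + t *: y', z] = [br x, y, z] + t *: [br x, y', z].
Proof. by rewrite addrC (tbr_linear2 x z t y' y) addrC. Qed.

Lemma tbr_affine3 (x y z z' : L) (t : K) :
  [br x, y, z + t *: z'] = [br x, y, z] + t *: [br x, y, z'].
Proof. by rewrite addrC (tbr_linear3 x y t z' z) addrC. Qed.

Lemma linear_affine (f : {linear V -> L}) v v' (t : K) :
  f (v + t *: v') = f v + t *: f v'.
Proof. by rewrite linearD linearZ. Qed.

(** A polarization of the O-operator identity: the outer map applied to each term
    of the bracket is the one attached to the argument that the term acts on.
    With this choice, replacing one of three copies of [T] by [S] produces, up
    to a value of [S], one term of the cocycle condition for [S]. *)
Definition O_defect (P Q R : {linear V -> L}) (u v w : V) : L :=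
  [br P u, Q v, R w] - R (rep_D theta (P u) (Q v) w)
  - P (theta (Q v) (R w) u) + Q (theta (P u) (R w) v).

Lemma O_defect_eq0 (T : {linear V -> L}) :
  O_operator theta T -> forall u v w, O_defect T T T u v w = 0.
Proof.
move=> hT u v w; rewrite /O_defect hT /br_O linearB linearD /=.
by rewrite -(addrA _ (- _) (- _)) -opprD [X in X + _]addrAC subrr add0r addNr.
Qed.

Lemma affine_collect (a b c d a' b' c' d' : L) (t : K) :
  (a + t *: a') - (b + t *: b') - (c + t *: c') + (d + t *: d')
  = (a - b - c + d) + t *: (a' - b' - c' + d').
Proof.
rewrite !opprD (addrACA a) (addrACA (a - b)) (addrACA (a - b - c)).
by rewrite -!scalerBr -scalerDr.
Qed.

Lemma O_defect_affine1 (P S Q R : {linear V -> L}) t u v w :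
  O_defect (deformation P S t) Q R u v w
  = O_defect P Q R u v w + t *: O_defect S Q R u v w.
Proof.
rewrite /O_defect /= tbr_affine1 rep_D_affine1 rep_affine1 !linear_affine.
exact: affine_collect.
Qed.

Lemma O_defect_affine2 (P Q S R : {linear V -> L}) t u v w :
  O_defect P (deformation Q S t) R u v w
  = O_defect P Q R u v w + t *: O_defect P S R u v w.
Proof.
rewrite /O_defect /= tbr_affine2 rep_D_affine2 rep_affine1 !linear_affine.
exact: affine_collect.
Qed.

Lemma O_defect_affine3 (P Q R S : {linear V -> L}) t u v w :
  O_defect P Q (deformation R S t) u v w
  = O_defect P Q R u v w + t *: O_defect P Q S u v w.
Proof.
rewrite /O_defect /= tbr_affine3 !rep_affine2 !linear_affine.
exact: affine_collect.
Qed.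

(** Expanding the defect of [T + t S] slot by slot; the three summands form the
    coefficient of [t]. *)
Lemma O_defect_first_order (T S : {linear V -> L}) :
  [pchar K] =i pred0 -> O_operator theta T -> inf_deformation theta T S ->
  forall u v w,
  O_defect S T T u v w + O_defect T S T u v w + O_defect T T S u v w = 0.
Proof.
move=> charK hT hS u v w; set g := fun P Q R => O_defect P Q R u v w.
apply: (@cubic_vanish K L _ (g S S T + g S T S + g T S S) (g S S S)) => // t.
rewrite -[RHS](O_defect_eq0 (hS t) u v w).
rewrite O_defect_affine1 !O_defect_affine2 !O_defect_affine3 -!/(g _ _ _).
rewrite [g T T T]O_defect_eq0 // add0r !scalerDr !scalerA.
have t2 : t * t = t ^+ 2 by [].
have t3 : t * t * t = t ^+ 3 by rewrite t2 -exprSr.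
rewrite !(t2, t3).
by rewrite [LHS](AC (3*3*1) ((3*(2*6))*((1*5)*(4*7)))).
Qed.

(** By the cyclic identity the two brackets in [D_T] merge into one, and the
    terms [theta (x, T u) v] and [theta (x, T v) u] cancel. *)
Lemma rep_D_theta_O (T : {linear V -> L}) u v x :
  rep_D (theta_O theta T) u v x
  = [br T u, T v, x] - T (theta (T v) x u) + T (theta (T u) x v).
Proof.
have cyc : [br x, T v, T u] - [br x, T u, T v] = [br T u, T v, x].
  rewrite [X in X - _]tbr_skew -opprD; apply/esym/eqP.
  by rewrite -addr_eq0 addrA tbr_cyclic.
rewrite /rep_D /theta_O /rep_D (opprD [br _, _, _]) addrACA cyc.
rewrite -addrA -linearB; congr (_ + _).
rewrite addrC -linearB; congr (T _); rewrite !opprB.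
set a := theta x (T u) v; set b := theta (T v) x u.
set c := theta x (T v) u; set d := theta (T u) x v.
by rewrite addrC -(addrA d) -opprD (addrA a) addrA subrK.
Qed.

(** Each term of the cocycle condition is one of the three first-order defects,
    up to [S] applied to one summand of the bracket [u, v, w]_T. *)
Lemma inf_deformation_cocycle (T S : {linear V -> L}) :
  [pchar K] =i pred0 -> O_operator theta T -> inf_deformation theta T S ->
  (S : V -> L) \in cocycle1_pred theta T.
Proof.
move=> charK hT hS; apply/asboolP; split=> [|u v w]; first exact: linearP.
have := O_defect_first_order charK hT hS u v w.
have -> : theta_O theta T v w (S u)
    = O_defect S T T u v w + S (theta (T v) (T w) u).
  rewrite /theta_O /O_defect linearB /=.
  by rewrite [RHS]addrAC subrK addrA addrAC.
have -> : theta_O theta T u w (S v)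
    = - (O_defect T S T u v w - S (theta (T u) (T w) v)).
  rewrite /theta_O /O_defect linearB /= addrK (tbr_skew (T u)) !opprD !opprK.
  rewrite -addrA [X in _ + X]addrC; congr (_ + (_ + _)).
  by rewrite -linearN /rep_D opprB.
have -> : rep_D (theta_O theta T) u v (S w)
    = O_defect T T S u v w + S (rep_D theta (T u) (T v) w).
  by rewrite rep_D_theta_O /O_defect [RHS](ACl (1*3*4*(2*5))) /= addNr addr0.
rewrite /br_O => <-.
(* Generalizing keeps additive rewriting from unfolding these terms. *)
move: (O_defect S T T u v w) (O_defect T S T u v w) (O_defect T T S u v w).
move: (rep_D _ _ _ w) => e a b c.
rewrite opprK (linearB S) (linearD S) (AC (2*2*2) ((1*3*5)*(2*6*4))) /= addrK.
by rewrite addrC addrA addrAC.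
Qed.

(** Of the conditions on an equivalence, only the intertwining
    [phi_t T_t = T'_t psi_t] is compared to first order in [t]. *)
Lemma equiv_deformation_d_O (T T1 T1' : {linear V -> L}) :
  [pchar K] =i pred0 -> equiv_deformation theta T T1 T1' ->
  exists X, forall v, T1 v - T1' v = d_O theta T X v.
Proof.
move=> charK [X hX]; exists X => v.
(* [phi_1 = Id + [X, -]] is linear by assumption, hence so is its increment. *)
have br_lin : linear (wedge_br X).
  move=> s x y; have := lts_morphism_linear (O_morphism_lts (hX 1)) s x y.
  by rewrite !scale1r scalerDr addrACA => /addrI.
apply/eqP; rewrite -subr_eq0 /d_O; apply/eqP.
apply: (@cubic_vanish K L _ (wedge_br X (T1 v) - T1' (wedge_D theta X v)) 0)
  => // t.
have /= := O_morphism_comm (hX t) v; rewrite !linear_affine.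
have -> : wedge_br X (T v + t *: T1 v)
    = wedge_br X (T v) + t *: wedge_br X (T1 v).
  by rewrite addrC br_lin addrC.
move: (wedge_br X (T v)) (wedge_br X (T1 v)) (T (wedge_D theta X v)) => d e c.
move: (T1' (wedge_D theta X v)) (T1 v) (T1' v) => f a b.
move=> eq_at; rewrite !scalerDr !scalerA -!expr2 -!addrA in eq_at.
move/addrI in eq_at.
have -> : t *: (a - b - (c - d)) + t ^+ 2 *: (e - f) + t ^+ 3 *: 0
    = t *: a + (t *: d + t ^+ 2 *: e) - (t *: c + (t *: b + t ^+ 2 *: f)).
  rewrite scaler0 addr0 !scalerBr opprB !opprD.
  by rewrite [RHS](AC ((1*2)*(1*2)) (((1*5)*(2*4))*(3*6))).
by rewrite eq_at subrr.
Qed.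

End FirstOrder.

Theorem theorem5p1 (K : fieldType) (charK : [pchar K] =i pred0)
    (L : ltsType K) (V : lmodType K) (theta : ltsRep L V)
    (T T1 T1' : {linear V -> L})
    (hT : O_operator theta T)
    (hT1 : inf_deformation theta T T1)
    (hT1' : inf_deformation theta T T1')
    (hequiv : equiv_deformation theta T T1 T1') :
  exists f f' : cocycle1 theta T,
    [/\ sval f = (T1 : V -> L), sval f' = (T1' : V -> L)
      & cohomology1_class f = cohomology1_class f'].
Proof.
have zT1 := inf_deformation_cocycle charK hT hT1.
have zT1' := inf_deformation_cocycle charK hT hT1'.
have [X dX] := equiv_deformation_d_O charK hequiv.
exists (exist _ (T1 : V -> L) zT1), (exist _ (T1' : V -> L) zT1'); split=> //.
rewrite /cohomology1_class; apply/quotmod_classP/asboolP; exists X.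
by apply/funext => v; rewrite sval_cocycle1B dX.
Qed.
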